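(* Let $X$ be a finite set whose distance $d$ is generated by a connected weighted graph $(X,w)$. In the infimum defining the Arens–Eells norm, the class of functions $a(x,y)$ can be restricted to those satisfying both of the following conditions: (i) if $a(x,y)\neq0$, then $x$ and $y$ are close; (ii) the graph $\{(x,y): a(x,y)\neq0\}$ has no cycle. That is, for every $\xi\in M_0(X)$, $\|\xi\|_{\text{Æ}}$ equals the infimum of $\sum_{x,y\in X}|a(x,y)|\,d(x,y)$ over all $a\in\mathbb R^{X\times X}$ with $\xi=\sum_{x,y\in X}a(x,y)(\delta_x-\delta_y)$ that satisfy (i) and (ii).
   Context: A weight $w$ on a finite set $X$ is a symmetric map $X\times X\to[0,\infty)$; its support defines an undirected simple graph on $X$ with edges $\{x,y\}$ such that $w(x,y)>0$ (no loops), assumed connected. The length of a path is the sum of the weights of its edges, and $d(x,y)$ is the length of a shortest path joining $x$ and $y$. Two vertices $x,y$ are adjacent if $\{x,y\}$ is an edge; they are close if they are adjacent and $d(x,y)=w(x,y)$. In (ii), the graph is regarded as undirected: its edges are the pairs $\{x,y\}$ with $a(x,y)\ne 0$ or $a(y,x)\neq 0$. $M_0(X)$ is the vector space of functions $\xi:X\to\mathbb R$ with $\sum_{x\in X}\xi(x)=0$, and $\delta_x$ is the indicator function of $\{x\}$. The Arens–Eells norm on $M_0(X)$ is $$\|\xi\|_{\text{Æ}}=\inf\Big\{\sum_{x,y\in X}|a(x,y)|\,d(x,y)\ :\ a\in\mathbb R^{X\times X},\ \xi=\sum_{x,y\in X}a(x,y)(\delta_x-\delta_y)\Big\}.$$ 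*)

(* Defs.v *)
From HB Require Import structures.
From mathcomp Require Import all_boot all_order all_algebra.
From mathcomp Require Import boolp classical_sets reals ereal.

Set Implicit Arguments.
Unset Strict Implicit.
Unset Printing Implicit Defensive.
Import Order.TTheory GRing.Theory Num.Theory.
Local Open Scope ring_scope.
Local Open Scope classical_set_scope.

Definition is_weight (R : realType) (X : finType) (w : X -> X -> R) : Prop :=
  (forall x y, 0 <= w x y) /\ (forall x y, w x y = w y x).

(* The diagonal values of w are unconstrained and never give an edge. *)
Definition adjacent (R : realType) (X : finType) (w : X -> X -> R) : rel X :=
  fun x y => (x != y) && (0 < w x y).

Definition connected_weight (R : realType) (X : finType) (w : X -> X -> R) :
  Prop := forall x y, connect (adjacent w) x y.

(* Length of the path visiting x, then the successive elements of p. *)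
Fixpoint path_length (R : realType) (X : finType) (w : X -> X -> R)
    (x : X) (p : seq X) : R :=
  if p is y :: q then w x y + path_length w y q else 0.

Definition joins (R : realType) (X : finType) (w : X -> X -> R)
    (x y : X) (p : seq X) : Prop :=
  path (adjacent w) x p /\ last x p = y.

(* d x y is the length of a shortest path from x to y: it is attained and
   minimal. For a connected weight this determines d uniquely. *)
Definition generates (R : realType) (X : finType) (w d : X -> X -> R) : Prop :=
  forall x y,
    (exists2 p, joins w x y p & d x y = path_length w x p) /\
    (forall p, joins w x y p -> d x y <= path_length w x p).

Definition close (R : realType) (X : finType) (w d : X -> X -> R)
    (x y : X) : Prop :=
  adjacent w x y /\ d x y = w x y.

Definition M0 (R : realType) (X : finType) : set (X -> R) :=
  [set xi | \sum_x xi x = 0].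

Definition delta (R : realType) (X : finType) (x : X) : X -> R :=
  fun z => (z == x)%:R.

Definition represents (R : realType) (X : finType) (xi : X -> R)
    (a : X -> X -> R) : Prop :=
  forall z, xi z = \sum_x \sum_y a x y * (delta R x z - delta R y z).

Definition cost (R : realType) (X : finType) (d a : X -> X -> R) : R :=
  \sum_x \sum_y `|a x y| * d x y.

Definition AE_norm (R : realType) (X : finType) (d : X -> X -> R)
    (xi : X -> R) : R :=
  inf [set cost d a | a in [set a | represents xi a]].

Definition support_edge (R : realType) (X : finType) (a : X -> X -> R) :
  rel X := fun x y => (a x y != 0) || (a y x != 0).

(* Cycles of an undirected graph have at least three distinct vertices; in
   particular a x y and a y x both nonzero give one edge, not a cycle. Loops
   are not counted here: those of a support are excluded by closeness. *)
Definition acyclic (X : finType) (e : rel X) : Prop :=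
  forall c : seq X, ucycle e c -> (size c < 3)%N.

Definition close_support (R : realType) (X : finType) (w d a : X -> X -> R) :
  Prop := forall x y, a x y != 0 -> close w d x y.

(* Main.v *)
(** A representation is first pushed onto close edges: along a shortest path
    from [x] to [y] all consecutive vertices are close, so [delta x - delta y]
    is represented on those edges at cost [d x y].  Then, as long as the support
    contains a cycle, subtract [t] times a circulation [f] along it: the cost is
    linear in [t] as long as no coefficient changes sign, so going in the
    direction where it does not increase until a first coefficient vanishes
    yields a cheaper representation with smaller support. *)
Require Import Defs.
From HB Require Import structures.
From mathcomp Require Import all_boot all_order all_algebra.
From mathcomp Require Import boolp classical_sets reals ereal.
From mathcomp Require Import lra.

Set Implicit Arguments.
Unset Strict Implicit.
Unset Printing Implicit Defensive.
Import Order.TTheory GRing.Theory Num.Theory.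
Local Open Scope ring_scope.
Local Open Scope classical_set_scope.

(** * Weighted sums of absolute values along a line *)

(** As long as no [a i - t * f i] changes sign, the weighted sum is affine in [t] with slope
    [- D f], so one of the two directions does not increase it. *)
Lemma sum_norm_subr_le (R : realType) (I : finType) (a f c : I -> R) (i0 : I) :
  (forall i, 0 <= c i) -> (forall i, f i != 0 -> a i != 0) -> f i0 != 0 ->
  exists t, (exists2 i, f i != 0 & a i = t * f i) /\
    \sum_i `|a i - t * f i| * c i <= \sum_i `|a i| * c i.
Proof.
move=> c0 fa f0; pose D g := \sum_i Num.sg (a i) * g i * c i : R.
(* It suffices to treat increasing [t], with some coefficient moving towards zero; the other
   direction is [g := - f]. *)
suff key g : (forall i, g i != 0 -> a i != 0) -> 0 <= D g ->
    (exists i, 0 < Num.sg (a i) * g i) ->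
    exists t, (exists2 i, g i != 0 & a i = t * g i) /\
    \sum_i `|a i - t * g i| * c i <= \sum_i `|a i| * c i.
  have keyN : D f <= 0 -> (exists i, Num.sg (a i) * f i < 0) ->
    exists t, (exists2 i, f i != 0 & a i = t * f i) /\
    \sum_i `|a i - t * f i| * c i <= \sum_i `|a i| * c i.
    move=> Df [j jf]; case: (key (fun i => - f i)).
    - by move=> i; rewrite oppr_eq0; exact: fa.
    - rewrite /D (eq_bigr (fun i => - (Num.sg (a i) * f i * c i))) ?sumrN ?oppr_ge0//.
      by move=> i _; rewrite mulrN mulNr.
    - by exists j; rewrite mulrN oppr_gt0.
    move=> t [[i fi ai] le]; exists (- t); split.
      by exists i; rewrite ?mulNr -?mulrN// -oppr_eq0.
    by under eq_bigr do rewrite mulNr -mulrN.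
  have sg0 : Num.sg (a i0) * f i0 != 0 by rewrite mulf_neq0 ?sgr_eq0 ?fa.
  (* As [c] is nonnegative, a nonzero [D f] has a term of its own sign, hence a coefficient that
     shrinks in the chosen direction. If [D f] is zero both directions are allowed, and [i0] selects
     one. *)
  case: (ltgtP (D f) 0) => Df.
  - apply: keyN; first exact: ltW.
    apply/existsP; apply: contraLR Df => /existsPn h; rewrite -leNgt.
    by apply: sumr_ge0 => i _; rewrite mulr_ge0// leNgt.
  - apply: key => //; first exact: ltW.
    apply/existsP; apply: contraLR Df => /existsPn h; rewrite -leNgt.
    by apply: sumr_le0 => i _; rewrite mulr_le0_ge0// leNgt.
  - case: (ltgtP (Num.sg (a i0) * f i0) 0) sg0 => // s0 _.
      by apply: keyN; [rewrite Df|exists i0].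
    by apply: key => //; [rewrite Df|exists i0].
move=> ga Dg [j gj].
(* [P] marks the coefficients that shrink as [t] grows; [a i / g i] is the time at which such a
   coefficient vanishes, and [k] is the first to do so. *)
pose P i := 0 < Num.sg (a i) * g i.
have [k Pk kmin] := @arg_minP _ _ I j P (fun i => a i / g i) gj.
have gk : g k != 0 by apply: contraTneq Pk; rewrite /P => ->; rewrite mulr0 ltxx.
have ratio i : P i -> `|a i| = a i / g i * (Num.sg (a i) * g i).
  move=> Pi.
  have gi : g i != 0 by apply: contraTneq Pi; rewrite /P => ->; rewrite mulr0 ltxx.
  by rewrite mulrCA divfK// normrEsg.
set t := a k / g k in kmin.
exists t; split; first by exists k; rewrite // divfK.
have t0 : 0 <= t by rewrite -(pmulr_lge0 _ Pk) -ratio.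
(* Up to time [t] no sign has changed: indices in [P] vanish no earlier than [k], and the others do
   not move towards zero. *)
have normE i : `|a i - t * g i| = `|a i| - t * (Num.sg (a i) * g i).
  have [ai|ai] := eqVneq (a i) 0.
    have -> : g i = 0 by apply/eqP; apply: contra_eqT ai; exact: ga.
    by rewrite ai !mulr0 !subr0.
  have : 0 <= `|a i| - t * (Num.sg (a i) * g i).
    have [Pi|nPi] := boolP (P i).
      by rewrite subr_ge0 [leRHS]ratio// ler_pM2r// kmin.
    by rewrite subr_ge0 (le_trans _ (normr_ge0 _))// mulr_ge0_le0// leNgt.
  move=> /ger0_norm <-.
  by rewrite (normrEsg (a i)) mulrCA -mulrBr normrM normr_sg ai mul1r.
under eq_bigr do rewrite normE mulrBl -mulrA.
by rewrite sumrB -mulr_sumr gerBl mulr_ge0.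
Qed.

(** * Single arcs and linear combinations of representations *)

Definition arc (R : realType) (X : finType) (c : R) (x y : X) : X -> X -> R :=
  fun u v => if (u == x) && (v == y) then c else 0.

Lemma sum_arc (R : realType) (X : finType) (c : R) (x y : X)
    (F : R -> X -> X -> R) :
  (forall u v, F 0 u v = 0) ->
  \sum_u \sum_v F (arc c x y u v) u v = F c x y.
Proof.
move=> F0; rewrite pair_bigA (bigD1 (x, y))//= big1 ?addr0 /arc ?eqxx//.
by move=> [u v] /=; rewrite xpair_eqE => /negPf ->.
Qed.

Lemma represents_arc (R : realType) (X : finType) (c : R) (x y : X) :
  represents (fun z => c * (delta R x z - delta R y z)) (arc c x y).
Proof.
move=> z; rewrite (@sum_arc R X c x y (fun r u v => r * (delta R u z - delta R v z)))//.
by move=> u v; rewrite mul0r.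
Qed.

Lemma cost_arc (R : realType) (X : finType) (d : X -> X -> R) (c : R) (x y : X) :
  cost d (arc c x y) = `|c| * d x y.
Proof.
rewrite /cost (@sum_arc R X c x y (fun r u v => `|r| * d u v))//.
by move=> u v; rewrite normr0 mul0r.
Qed.

Lemma represents_lin (R : realType) (X : finType) (xi zeta : X -> R)
    (a b : X -> X -> R) (t : R) :
  represents xi a -> represents zeta b ->
  represents (fun z => xi z + t * zeta z) (fun x y => a x y + t * b x y).
Proof.
move=> xia zb z; rewrite xia zb mulr_sumr -big_split; apply: eq_bigr => x _.
rewrite mulr_sumr -big_split; apply: eq_bigr => y _ /=.
by rewrite mulrDl mulrA.
Qed.

Lemma eq_represents (R : realType) (X : finType) (xi zeta : X -> R)
    (a : X -> X -> R) :
  represents xi a -> xi =1 zeta -> represents zeta a.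
Proof. by move=> xia e z; rewrite -e. Qed.

(** All mass is sent to one base point [x0], where the total received is zero. This makes the set
    under the infimum nonempty. *)
Lemma M0_represents (R : realType) (X : finType) (xi : X -> R) :
  M0 xi -> exists a, represents xi a.
Proof.
move=> xi0; case: (pickP X) => [x0 _|X0]; last first.
  by exists (fun _ _ => 0) => z; have := X0 z.
exists (fun x y => xi x * (y == x0)%:R) => z.
transitivity (\sum_x xi x * (delta R x z - delta R x0 z)).
  under eq_bigr do rewrite mulrBr.
  rewrite sumrB -mulr_suml xi0 mul0r subr0 (bigD1 z)//= /delta eqxx mulr1.
  by rewrite big1 ?addr0// => x; rewrite eq_sym => /negPf ->; rewrite mulr0.
apply: eq_bigr => x _; rewrite (bigD1 x0)//= eqxx mulr1 big1 ?addr0//.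
by move=> y /negPf ->; rewrite mulr0 mul0r.
Qed.

Lemma addr_neq0 (V : zmodType) (x y : V) : x + y != 0 -> x != 0 \/ y != 0.
Proof. by have [->|] := eqVneq x 0; [rewrite add0r; right|left]. Qed.

Lemma path_length_ge0 (R : realType) (X : finType) (w : X -> X -> R) x p :
  is_weight w -> 0 <= path_length w x p.
Proof.
by case=> w0 _; elim: p x => //= y p IH x; rewrite addr_ge0.
Qed.

Lemma path_length_cat (R : realType) (X : finType) (w : X -> X -> R) x p q :
  path_length w x (p ++ q) = path_length w x p + path_length w (last x p) q.
Proof. by elim: p x => [|y p IH] x /=; rewrite ?add0r// IH addrA. Qed.

(** * Reduction to close edges *)

Section Distance.
Variables (R : realType) (X : finType) (w d : X -> X -> R).
Hypotheses (hw : is_weight w) (hd : generates w d).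

Lemma dist_ge0 x y : 0 <= d x y.
Proof. by have [[p _ ->] _] := hd x y; exact: path_length_ge0. Qed.

Lemma dist_triangle x y z : d x z <= d x y + d y z.
Proof.
have [[p [pp lp] ->] _] := hd x y; have [[q [pq lq] ->] _] := hd y z.
rewrite -{1}lp -path_length_cat; apply: (hd x z).2.
by split; rewrite ?cat_path ?last_cat lp ?pp.
Qed.

Lemma dist_le_path x p : path (adjacent w) x p ->
  d x (last x p) <= path_length w x p.
Proof. by move=> px; apply: (hd _ _).2. Qed.

Lemma shortest_path_represents x p : path (adjacent w) x p ->
  d x (last x p) = path_length w x p ->
  exists b, [/\ represents (fun z => delta R x z - delta R (last x p) z) b,
    close_support w d b & cost d b <= d x (last x p)].
Proof.
elim: p x => [|y p IH] x /=.
  move=> _ ->; exists (arc 0 x x); split.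
  - by apply: eq_represents (represents_arc _ _ _) _ => z; rewrite mul0r subrr.
  - by move=> u v; rewrite /arc if_same eqxx.
  - by rewrite cost_arc normr0 mul0r.
case/andP=> axy py dx.
(* The chain [d x last <= d x y + d y last <= w x y + path_length] has equal ends, so the first edge
   is close and the tail is again a shortest path. *)
have dxy : d x y <= w x y.
  by have := @dist_le_path x [:: y]; rewrite /= axy addr0; apply.
have tri := dist_triangle x y (last y p).
have dyp := dist_le_path py.
have [|b [rb cb lb]] := IH y py; first by lra.
exists (fun u v => arc 1 x y u v + 1 * b u v); split.
- apply: eq_represents (represents_lin 1 (represents_arc 1 x y) rb) _ => z.
  by rewrite !mul1r addrA subrK.
- move=> u v /addr_neq0[]; last by rewrite mul1r; exact: cb.
  rewrite /arc; case: ifP => [/andP[/eqP -> /eqP ->] _|]; last by rewrite eqxx.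
  by split=> //; lra.
- have -> : d x (last y p) = d x y + d y (last y p) by lra.
  apply: (@le_trans _ _ (cost d (arc 1 x y) + cost d b)).
    rewrite /cost -big_split ler_sum// => u _; rewrite -big_split ler_sum// => v _ /=.
    by rewrite -mulrDl ler_wpM2r ?dist_ge0// mul1r ler_normD.
  by rewrite cost_arc normr1 mul1r lerD2l.
Qed.

(** Each [delta x - delta y] is replaced by its shortest-path representation, scaled by [a x y].
    Overlaps can only lower the cost, by the triangle inequality for absolute values. *)
Lemma close_representation xi a : represents xi a ->
  exists b, [/\ represents xi b, close_support w d b & cost d b <= cost d a].
Proof.
move=> xia.
have /choice[b hb] : forall p : X * X, exists b : X -> X -> R,
    [/\ represents (fun z => delta R p.1 z - delta R p.2 z) b,
    close_support w d b & cost d b <= d p.1 p.2].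
  move=> [x y]; have [[p [pp lp] dp] _] := hd x y.
  by rewrite /= -lp; apply: shortest_path_represents => //; rewrite lp.
exists (fun u v => \sum_p a p.1 p.2 * b p u v); split.
- move=> z; rewrite xia pair_bigA /=.
  transitivity (\sum_p a p.1 p.2 *
      \sum_(q : X * X) b p q.1 q.2 * (delta R q.1 z - delta R q.2 z)).
    by apply: eq_bigr => p _; have [-> _ _] := hb p; rewrite pair_bigA.
  under [LHS]eq_bigr do rewrite mulr_sumr.
  rewrite [LHS]exchange_big [RHS]pair_bigA; apply: eq_bigr => q _ /=.
  by rewrite mulr_suml; apply: eq_bigr => p _; rewrite mulrA.
- move=> u v sn0; have : [exists p : X * X, b p u v != 0].
    apply: contraNT sn0 => /existsPn h; apply/eqP/big1 => p _.
    by have := h p; rewrite negbK => /eqP ->; rewrite mulr0.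
  by case/existsP=> p; have [_ cb _] := hb p; exact: cb.
- have -> : cost d a = \sum_p `|a p.1 p.2| * d p.1 p.2.
    by rewrite /cost pair_bigA.
  apply: (@le_trans _ _ (\sum_p `|a p.1 p.2| * cost d (b p))); last first.
    by apply: ler_sum => p _; apply: ler_wpM2l => //; have [] := hb p.
  rewrite /cost; under [leRHS]eq_bigr do rewrite pair_bigA mulr_sumr.
  rewrite [leRHS]exchange_big [leLHS]pair_bigA; apply: ler_sum => q _ /=.
  under [leRHS]eq_bigr do rewrite mulrA -normrM.
  by rewrite -mulr_suml ler_wpM2r ?dist_ge0// ler_norm_sum.
Qed.

End Distance.

(** * Circulations along cycles of the support *)

Section Circulation.
Variables (R : realType) (X : finType) (a : X -> X -> R).

(* The unit flow from x to y, placed on an arc of the support of a. *)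
Definition edge_flow x y : X -> X -> R :=
  if a x y != 0 then arc 1 x y else arc (-1) y x.

Lemma represents_edge_flow x y :
  represents (fun z => delta R x z - delta R y z) (edge_flow x y).
Proof.
rewrite /edge_flow; case: ifP => _.
  by apply: eq_represents (represents_arc _ _ _) _ => z; rewrite mul1r.
by apply: eq_represents (represents_arc _ _ _) _ => z; rewrite mulN1r opprB.
Qed.

Lemma edge_flow_support x y u v : support_edge a x y -> edge_flow x y u v != 0 ->
  [/\ a u v != 0, u \in [:: x; y] & v \in [:: x; y]].
Proof.
rewrite /support_edge /edge_flow /arc; case: ifP => /= [axy _|_ ayx];
  by case: ifP => [/andP[/eqP -> /eqP ->]|]; rewrite ?eqxx// !inE !eqxx ?orbT.
Qed.

Lemma edge_flow_neq0 x y :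
  edge_flow x y x y != 0 \/ edge_flow x y y x != 0.
Proof.
by rewrite /edge_flow /arc; case: ifP => _; [left|right];
  rewrite !eqxx ?oppr_eq0 oner_neq0.
Qed.

(** The edge flows telescope. Confining the flow to the vertices of the path is what later rules out
    cancellation on a cycle. *)
Lemma path_flow x p : path (support_edge a) x p ->
  exists f, represents (fun z => delta R x z - delta R (last x p) z) f /\
    forall u v, f u v != 0 -> [/\ a u v != 0, u \in x :: p & v \in x :: p].
Proof.
elim: p x => [|y p IH] x /=.
  move=> _; exists (arc 0 x x); split.
    by apply: eq_represents (represents_arc _ _ _) _ => z; rewrite mul0r subrr.
  by move=> u v; rewrite /arc if_same eqxx.
case/andP=> exy /IH[f [rf sf]].
exists (fun u v => edge_flow x y u v + 1 * f u v); split.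
  apply: eq_represents (represents_lin 1 (represents_edge_flow x y) rf) _ => z.
  by rewrite mul1r addrA subrK.
move=> u v /addr_neq0[/(edge_flow_support exy)|].
  by case=> auv; rewrite !inE => /orP[] -> /orP[] ->; rewrite auv ?orbT.
by rewrite mul1r => /sf[auv ux vx]; rewrite !(in_cons x) ux vx !orbT.
Qed.

Lemma cycle_circulation : ~ acyclic (support_edge a) ->
  exists f : X -> X -> R, [/\ represents (fun=> 0) f, forall u v, f u v != 0 -> a u v != 0
    & exists u v, f u v != 0].
Proof.
move=> /existsNP[c /not_implyP[/andP[]]].
case: c => [|x [|y [|z c]]]//= + + _.
rewrite !inE !negb_or => /and3P[exy eyz pz] /and3P[/and3P[xy xz xc] /andP[yz yc] _].
have [h [rh sh]] := path_flow pz; rewrite last_rcons in rh.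
(* The first two edges are split off so that [{x, y}] can be isolated: the flow on [{y, z}] avoids
   [x], and the return path from [z] to [x] avoids [y]. Hence nothing cancels the flow on
   [{x, y}]. *)
exists (fun u v => edge_flow x y u v + 1 * (edge_flow y z u v + 1 * h u v)); split.
- apply: eq_represents (represents_lin 1 (represents_edge_flow x y)
    (represents_lin 1 (represents_edge_flow y z) rh)) _ => t.
  by rewrite !mul1r (addrA (_ - _) (delta _ z t)) subrK addrA subrK subrr.
- move=> u v /addr_neq0[/(edge_flow_support exy)[]//|].
  rewrite mul1r => /addr_neq0[/(edge_flow_support eyz)[]//|].
  by rewrite mul1r => /sh[].
- have yh : y \notin z :: rcons c x.
    by rewrite !(inE, mem_rcons) !negb_or yz (eq_sym y) xy.
  have xe : x \notin [:: y; z] by rewrite !inE negb_or xy.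
  have e0 u v : (u == x) || (v == x) -> edge_flow y z u v = 0.
    move=> uv; apply/eqP; apply: contraT => /(edge_flow_support eyz)[_ uy vy].
    by case/orP: uv => /eqP e; move: xe; rewrite -e ?uy ?vy.
  have h0 u v : (u == y) || (v == y) -> h u v = 0.
    move=> uv; apply/eqP; apply: contraT => /sh[_ uy vy].
    by case/orP: uv => /eqP e; move: yh; rewrite -e ?uy ?vy.
  case: (edge_flow_neq0 x y) => ne; [exists x, y|exists y, x];
    by rewrite e0 ?h0 ?eqxx ?orbT// mulr0 !addr0 mulr0 addr0.
Qed.

End Circulation.

(** * Removal of cycles and conclusion *)

Lemma acyclic_representation (R : realType) (X : finType) (d : X -> X -> R)
    (xi : X -> R) (a : X -> X -> R) :
  (forall x y, 0 <= d x y) -> represents xi a ->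
  exists b, [/\ represents xi b, forall x y, b x y != 0 -> a x y != 0,
    acyclic (support_edge b) & cost d b <= cost d a].
Proof.
move=> d0; have [n] := ubnP #|[pred p : X * X | a p.1 p.2 != 0]|.
elim: n a => // n IH a; rewrite ltnS => an xia.
have [ac|/cycle_circulation[f [f0 fa [u [v fuv]]]]] :=
  pselect (acyclic (support_edge a)); first by exists a.
have [t [[[x y] /= fxy axy] le]] := @sum_norm_subr_le R _
  (fun p : X * X => a p.1 p.2) (fun p => f p.1 p.2) (fun p => d p.1 p.2) (u, v)
  (fun p => d0 p.1 p.2) (fun p => fa p.1 p.2) fuv.
pose a' x y := a x y + (- t) * f x y.
have a'a u' v' : a' u' v' != 0 -> a u' v' != 0.
  by case/addr_neq0 => //; rewrite mulf_eq0 negb_or => /andP[_ /fa].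
have [||b [rb ba' acb cb]] := IH a'.
(* The support of [a'] lies in that of [a] and has lost [(x, y)], so the induction on its size
   applies. *)
- apply: leq_trans an; apply: proper_card; apply/properP; split.
    by apply/fintype.subsetP => -[u' v']; rewrite !inE; exact: a'a.
  by exists (x, y); rewrite !inE /= ?fa// /a' axy mulNr subrr eqxx.
- apply: eq_represents (represents_lin (- t) xia f0) _ => z.
  by rewrite mulr0 addr0.
exists b; split=> // [u' v' /ba'/a'a//|]; apply: le_trans cb _.
rewrite /cost !pair_bigA /=; apply: le_trans le.
by apply: ler_sum => p _; rewrite /a' mulNr.
Qed.

(* MathComp world. The restricted infimum is taken in the extended reals, where
   the infimum of the empty set is +oo, so the equality is never a default
   value. *)
Theorem theorem3 (R : realType) (X : finType) (w d : X -> X -> R)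
  (hw : is_weight w) (hconn : connected_weight w) (hd : generates w d)
  (xi : X -> R) (hxi : M0 xi) :
  (AE_norm d xi)%:E =
  ereal_inf [set (cost d a)%:E | a in
    [set a | [/\ represents xi a, close_support w d a
               & acyclic (support_edge a)]]].
Proof.
have d0 := dist_ge0 hw hd.
have cost0 a : 0 <= cost d a.
  by apply: sumr_ge0 => x _; apply: sumr_ge0 => y _; rewrite mulr_ge0.
have lbS : has_lbound [set cost d a | a in [set a | represents xi a]].
  by exists 0 => _ [a _ <-].
apply/eqP; rewrite eq_le; apply/andP; split.
  apply: le_ereal_inf_tmp => _ [a [xia _ _] <-]; rewrite lee_fin.
  by apply: ge_inf => //; exists a.
apply/lee_addgt0Pr => e e0.
(* A near-minimizer is first made close, then acyclic: in this order closeness survives, because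
   removing cycles never enlarges the support. *)
have [|_ [a xia <-] ae] := @inf_adherent _ _ e e0
    (conj _ lbS : has_inf [set cost d a | a in [set a | represents xi a]]).
  by have [a xia] := M0_represents hxi; exists (cost d a), a.
have [b [xib cb ba]] := close_representation hw hd xia.
have [b' [xib' b'b acb' b'c]] := acyclic_representation d0 xib.
apply: (@le_trans _ _ (cost d b')%:E); last first.
  by rewrite -EFinD lee_fin; apply: le_trans b'c (le_trans ba (ltW ae)).
by apply: ereal_inf_lbound; exists b' => //; split=> // x y /b'b; exact: cb.
Qed.
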